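(* Let $\mathcal H_0,\mathcal H_1$ be Hilbert spaces and let $(T_n)_{n\in\mathbb N}$ be a sequence of compact linear operators $T_n:\mathcal H_0\to\mathcal H_1$. Assume that $(T_n)_n$ is collectively compact and that $T_n$ converges strongly to a bounded operator $T_0\in\mathcal L(\mathcal H_0,\mathcal H_1)$, i.e. $T_nx\to T_0x$ in $\mathcal H_1$ for every $x\in\mathcal H_0$. Assume in addition that $(T_n)_n$ has the property that $$u_n\rightharpoonup u\ \text{ in }\mathcal H_0\quad\Rightarrow\quad \exists\,(u_{n_k})_k\subset(u_n)_n:\ \ T_{n_k}u_{n_k}\to T_0u .$$ Then $T_0$ is compact and $\|T_n-T_0\|_{\mathcal L(\mathcal H_0,\mathcal H_1)}\to0$ as $n\to+\infty$.
   Context: A family $\mathcal K$ of compact linear operators from a Hilbert space $X$ to a Hilbert space $Y$ is called collectively compact if the set $\{Kx: K\in\mathcal K,\ x\in B\}$, where $B$ is the unit ball of $X$, is precompact in $Y$. $\mathcal L(X,Y)$ denotes the bounded linear operators from $X$ to $Y$, $\rightharpoonup$ weak convergence, and $(u_{n_k})_k\subset(u_n)_n$ means that $(u_{n_k})_k$ is a subsequence of $(u_n)_n$.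
   Formalization: The weak-convergence property is assumed for every subsequence of (T_n), not only for (T_n) itself; as literally stated the claim fails (T_n = <·,e_n> on l^2 for n even, T_n = 0 for n odd, T_0 = 0). *)

(* Defs.v *)
From HB Require Import structures.
From mathcomp Require Import all_boot all_order all_algebra.
From mathcomp Require Import sesquilinear complex.
From mathcomp Require Import all_classical all_reals all_analysis.

Set Implicit Arguments.
Unset Strict Implicit.
Unset Printing Implicit Defensive.

Import Order.TTheory GRing.Theory Num.Theory.
Import numFieldNormedType.Exports.

Local Open Scope classical_set_scope.
Local Open Scope ring_scope.

(* Hilbert spaces may be real or complex: the scalar field is either R or R[i],
   with the corresponding conjugation and real part. *)
Variant scalar_kind := RealScalars | ComplexScalars.

Definition scalars (R : realType) (k : scalar_kind) : numFieldType :=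
  match k with RealScalars => R | ComplexScalars => R[i] end.

Definition scalar_conj (R : realType) (k : scalar_kind) :
    scalars R k -> scalars R k :=
  match k with RealScalars => idfun | ComplexScalars => @Num.conj R[i] end.

Definition scalar_re (R : realType) (k : scalar_kind) : scalars R k -> R :=
  match k with RealScalars => idfun | ComplexScalars => @complex.Re R end.

(* A Hilbert space is a complete normed module together with an inner product
   dot, linear in its first argument, that induces its norm. *)
Definition induces_norm (R : realType) (k : scalar_kind)
    (H : completeNormedModType (scalars R k))
    (dot : {dot H for @scalar_conj R k}) : Prop :=
  forall x : H, `|x| ^+ 2 = dot x x.

Definition weak_cvg (K : numFieldType) (X : normedModType K)
    (u : nat -> X) (l : X) : Prop :=
  forall f : {scalar X}, continuous f -> f (u n) @[n --> \oo] --> f l.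

Section Operators.
Context {K : numFieldType} {X Y : normedModType K}.

Definition unit_ball : set X := [set x | `|x| <= 1].

Definition bounded_operator (f : {linear X -> Y}) : Prop :=
  exists M : K, forall x, `|f x| <= M * `|x|.

Definition compact_operator (f : {linear X -> Y}) : Prop :=
  precompact (f @` unit_ball).

Definition collectively_compact (F : set {linear X -> Y}) : Prop :=
  (forall f, F f -> compact_operator f) /\
  precompact [set (f : {linear X -> Y}) x | f in F & x in unit_ball].

(* T j is applied to u j with the same index.  This property is not inherited
   by subsequences of T: with T (2 j) = <., e_(2 j)> for an orthonormal family e
   and T (2 j + 1) = 0, it holds for T (and T0 = 0) but not for j |-> T (2 j). *)
Definition weak_subsequence_property
    (T : nat -> {linear X -> Y}) (T0 : {linear X -> Y}) : Prop :=
  forall (u : nat -> X) (l : X), weak_cvg u l ->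
  exists2 psi : nat -> nat,
    increasing_seq psi & T (psi j) (u (psi j)) @[j --> \oo] --> T0 l.

End Operators.

(* `|f x| is an element of the scalar field, hence the real part. *)
Definition operator_norm (R : realType) (k : scalar_kind)
    (X Y : normedModType (scalars R k)) (f : {linear X -> Y}) : \bar R :=
  ereal_sup [set (scalar_re `|f x|)%:E | x in unit_ball].

(* Main.v *)
(* Compactness of T0: its unit ball image lies in the closure of the precompact
   union of the images under the T n.  For uniform convergence, suppose that
   |(T n - T0) x| > d for infinitely many n, with unit vectors x depending on n.
   Since T n - T0 tends to 0 pointwise, hence uniformly on the unit ball of the
   span of finitely many vectors, a gliding hump makes these x pairwise
   orthogonal, with d / 2 in place of d.  A bounded orthogonal sequence is weakly
   null, so no weak compactness of balls is needed: along a subsequence T n x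
   tends to T0 0 = 0, and, T0 being compact, T0 x clusters at 0; this contradicts
   the lower bound d / 2. *)
Require Import Defs.
From HB Require Import structures.
From mathcomp Require Import all_boot all_order all_algebra.
From mathcomp Require Import sesquilinear complex.
From mathcomp Require Import all_classical all_reals all_analysis.
Import Order.TTheory GRing.Theory Num.Theory.
Import numFieldNormedType.Exports.
Local Open Scope classical_set_scope.
Local Open Scope ring_scope.

(** * Sequences built term by term *)

(** Dependent choice with the whole history as state: each new term is chosen against the finite
    list of all earlier ones. It yields both subsequences and the gliding hump. *)
Lemma pairwise_sequence (X : Type) (P : pred X) (r : rel X) :
    (forall s, all P s -> pairwise r s -> exists2 x, P x & all (r^~ x) s) ->
  exists2 u : nat -> X,
    forall n, P (u n) & forall i j, (i < j)%N -> r (u i) (u j).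
Proof.
move=> ext; pose Q s := all P s && pairwise r s.
have [x0 _ _] := ext [::] isT isT.
have /choice[g gP] : forall s, exists x, Q s -> Q (rcons s x).
  move=> s; have [/andP[Ps rs]|] := boolP (Q s); last by exists x0.
  have [x Px rx] := ext s Ps rs; exists x => _.
  by rewrite /Q all_rcons pairwise_rcons Px rx Ps.
pose S n := iter n (fun s => rcons s (g s)) [::].
(* The state [S n] lists exactly the first [n] terms of [g \o S], so the invariant [Q] of the states
   passes to that sequence. *)
have SE n : S n = mkseq (g \o S) n by elim: n => // n IHn; rewrite mkseqS -IHn.
have SQ n : Q (mkseq (g \o S) n) by rewrite -SE; elim: n => //= n /gP.
exists (g \o S) => [n|i j ij].
  by have /andP[+ _] := SQ n.+1; rewrite mkseqS all_rcons => /andP[].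
have /andP[_] := SQ j.+1; rewrite mkseqS pairwise_rcons => /andP[+ _].
by rewrite all_map => /allP; apply; rewrite mem_iota.
Qed.

Lemma frequently_subsequence (P : nat -> Prop) :
    (forall N, exists2 n, (N <= n)%N & P n) ->
  exists2 phi : nat -> nat, increasing_seq phi & forall n, P (phi n).
Proof.
move=> infP; have [s _ _|phi phiP phi_lt] :=
  @pairwise_sequence nat (fun n => `[< P n >]) ltn.
  have [n n_gt Pn] := infP (\max_(m <- s) m).+1.
  exists n; first exact/asboolP.
  by apply/allP => m ms; apply: leq_trans n_gt; rewrite ltnS leq_bigmax_seq.
exists phi => [|n]; last exact/asboolP.
by apply/increasing_seqP => n; exact: phi_lt.
Qed.

Lemma increasing_seq_cvg_infty (phi : nat -> nat) :
  increasing_seq phi -> phi n @[n --> \oo] --> \oo.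
Proof.
move=> phi_incr A [N _ NA]; exists N => // n /= Nn; apply: NA => /=.
have phi_ge m : (m <= phi m)%N.
  by elim: m => // m /leq_ltn_trans; apply; rewrite (leqW_mono phi_incr).
exact: leq_trans (phi_ge n).
Qed.

(** * Orthogonal projections and orthogonal sequences *)

Section Geometry.
Context {K : numFieldType} {X : normedModType K} {theta : K -> K}.
Variable dot : {dot X for theta}.
Hypothesis norm_dot : forall x : X, `|x| ^+ 2 = dot x x.

Lemma dot_swap_eq0 x y : dot x y = 0 -> dot y x = 0.
Proof.
have hs u v : dot u v = theta (dot v u).
  by rewrite [LHS](@hermitian_subproof _ _ _ _ dot) expr0 mul1r.
(* No additivity of [theta] is assumed: [theta 0 = 0] is read off from [dot 0 0 = 0]. *)
by move=> xy0; rewrite hs xy0 -[X in theta X](linear0l dot 0) -hs linear0l.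
Qed.

Lemma pythagoras x y : dot x y = 0 -> `|x + y| ^+ 2 = `|x| ^+ 2 + `|y| ^+ 2.
Proof.
move=> xy0; rewrite !norm_dot linearDl !linearDr.
by rewrite /= xy0 (dot_swap_eq0 _ _ xy0) addr0 add0r.
Qed.

(* When [e = 0] the coefficient is the junk value [0]. *)
Definition proj_coef (e x : X) : K := dot x e / `|e| ^+ 2.

Lemma proj_coef_orthogonal e x : dot (x - proj_coef e x *: e) e = 0.
Proof.
rewrite linearBl linearZl_LR /= -norm_dot /proj_coef.
have [->|e0] := eqVneq e 0; first by rewrite linear0r normr0 expr0n mulr0 subr0.
by rewrite /= divfK ?subrr// expf_neq0 // normr_eq0.
Qed.

Lemma pythagoras_proj e x :
  `|x| ^+ 2 = `|x - proj_coef e x *: e| ^+ 2 + (`|proj_coef e x| * `|e|) ^+ 2.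
Proof.
rewrite -normrZ -pythagoras ?subrK//.
apply: dot_swap_eq0; rewrite linearZl_LR /=.
by rewrite dot_swap_eq0 ?mulr0 ?proj_coef_orthogonal.
Qed.

Lemma norm_sub_proj_le e x : `|x - proj_coef e x *: e| <= `|x|.
Proof.
by rewrite -(@ler_pXn2r _ 2) ?nnegrE// (pythagoras_proj e x) lerDl exprn_ge0 ?mulr_ge0.
Qed.

(** The projection of [x] onto [y] has norm |dot x y| / |y|, which is at most |x| by Pythagoras. *)
Lemma cauchy_schwarz x y : `|dot x y| <= `|x| * `|y|.
Proof.
have [->|y0] := eqVneq y 0; first by rewrite linear0r !normr0 mulr0.
have y_gt0 : 0 < `|y| by rewrite normr_gt0.
have : `|proj_coef y x| * `|y| <= `|x|.
  rewrite -(@ler_pXn2r _ 2) ?nnegrE ?mulr_ge0//.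
  by rewrite (pythagoras_proj y x) lerDr exprn_ge0.
rewrite -(ler_pM2r y_gt0); congr (_ <= _).
rewrite -mulrA -expr2 /proj_coef normf_div normrX normr_id divfK//.
by rewrite expf_neq0// gt_eqF.
Qed.

Lemma norm_sum_orthogonal_le (x : nat -> X) (c : K) (n : nat) :
    (forall i j, (i < j)%N -> dot (x i) (x j) = 0) ->
    (forall i, `|x i| <= c) ->
  `|\sum_(i < n) x i| ^+ 2 <= n%:R * c ^+ 2.
Proof.
move=> ortho x_le; elim: n => [|n IHn].
  by rewrite big_ord0 normr0 expr0n mul0r.
have sum_ortho : dot (\sum_(i < n) x i) (x n) = 0.
  elim/big_ind: _ => [|u v u0 v0|i _]; first exact: linear0l.
  - by rewrite linearDl /= u0 v0 addr0.
  - exact: ortho.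
rewrite big_ord_recr /= pythagoras// -[n.+1]addn1 natrD mulrDl mul1r lerD//.
by apply: lerXn2r; rewrite ?nnegrE// (le_trans _ (x_le n)).
Qed.

(* If [|f (x i)| >= d] along a subsequence, the averages of the orthogonal
   vectors [x i / f (x i)] tend to 0 although [f] is 1 at each of them. *)
Lemma orthogonal_weak_cvg0 (x : nat -> X) :
    (forall c : K, 0 <= c -> exists n : nat, c < n%:R) ->
    (forall i j, (i < j)%N -> dot (x i) (x j) = 0) ->
    (forall i, `|x i| <= 1) ->
  weak_cvg x 0.
Proof.
move=> archi ortho x_le1 f f_cont; rewrite linear0; apply/cvgr0Pnorm_lt => d d0.
apply: contrapT => not_small.
have [N|phi phi_incr f_ge] := @frequently_subsequence (fun n => d <= `|f (x n)|).
  apply: contrapT => small; apply: not_small; exists N => // n /= Nn.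
  by rewrite real_ltNge ?normr_real ?gtr0_real//; apply/negP => ?; apply: small; exists n.
have phi_lt i j : (i < j)%N -> (phi i < phi j)%N by rewrite (leqW_mono phi_incr).
have f_neq0 i : f (x (phi i)) != 0 by rewrite -normr_gt0 (lt_le_trans d0).
pose y i := (f (x (phi i)))^-1 *: x (phi i).
have y_ortho i j : (i < j)%N -> dot (y i) (y j) = 0.
  by move=> ij; rewrite linearZl_LR linearZr_LR /= ortho ?mulr0 ?phi_lt.
have y_le i : `|y i| <= d^-1.
  rewrite normrZ normfV -[leRHS]mulr1 ler_pM ?invr_ge0//.
  by rewrite lef_pV2 ?posrE ?normr_gt0.
have [r r0 f_lt1] : exists2 r, 0 < r & forall w, `|w| < r -> `|f w| < 1.
  have := f_cont 0; rewrite /continuous_at linear0.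
  by move/cvgr0Pnorm_lt/(_ _ ltr01)/nbhs_norm0P => [r /= r0 rf]; exists r.
(* The average of [n] of the [y i] has squared norm at most [d ^- 2 / n]; this [n] brings it below
   [r ^+ 2]. *)
have [|n n_gt] := archi (d ^- 2 / r ^+ 2).
  by rewrite divr_ge0 ?invr_ge0 ?exprn_ge0 ?ltW.
have n0 : 0 < n%:R :> K.
  by apply: le_lt_trans n_gt; rewrite divr_ge0 ?invr_ge0 ?exprn_ge0 ?ltW.
have /f_lt1 : `|n%:R^-1 *: \sum_(i < n) y i| < r.
  rewrite -(@ltr_pXn2r _ 2) ?nnegrE ?(ltW r0)//.
  rewrite normrZ exprMn normfV normr_nat exprVn.
  apply: le_lt_trans (ler_wpM2l _ (norm_sum_orthogonal_le _ _ n y_ortho y_le)) _.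
    by rewrite invr_ge0 exprn_ge0 ?ltW.
  rewrite mulrA expr2 invfM mulrVK ?unitfE ?gt_eqF// exprVn.
  by rewrite mulrC ltr_pdivrMr// mulrC -ltr_pdivrMr// exprn_gt0.
rewrite scalarZ raddf_sum /=.
under eq_bigr do rewrite scalarZ mulVf//.
by rewrite sumr_const card_ord /= mulVf ?gt_eqF// normr1 ltxx.
Qed.

Context {Y : normedModType K}.

(* A pointwise null sequence of operators is uniformly small on the span of the
   finite family [s], so removing the component along [s] hardly matters. *)
Lemma eventually_orthogonal_approx (A : nat -> {linear X -> Y}) (s : seq X) :
    (forall x, A n x @[n --> \oo] --> 0) ->
    pairwise (fun u v => dot u v == 0) s ->
  forall d : K, 0 < d -> \forall n \near \oo, forall x, `|x| <= 1 ->
  exists y, [/\ `|y| <= 1, all (fun u => dot u y == 0) s & `|A n (x - y)| <= d].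
Proof.
move=> A0; elim: s => [_ d d0|e s IHs /= /andP[e_ortho s_ortho] d d0].
  by near=> n => x x1; exists x; split=> //; rewrite subrr linear0 normr0 ltW.
(* The factor |e| makes the bound scale with [e]: the component of a vector of norm at most 1 along
   [e] is then sent to norm at most [d / 2]. *)
have Ae_le : \forall n \near \oo, `|A n e| <= d / 2 * `|e|.
  have [->|e0] := eqVneq e 0.
    by near=> n; rewrite linear0 !normr0 mulr0.
  have : 0 < d / 2 * `|e| by rewrite mulr_gt0 ?divr_gt0 ?normr_gt0.
  by move=> /(cvgr0_norm_lt _ (A0 e)); apply: filterS => n /ltW.
near=> n => x x1.
have [y [y1 y_ortho Axy]] : exists y,
    [/\ `|y| <= 1, all (fun u => dot u y == 0) s & `|A n (x - y)| <= d / 2].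
  move: x x1; near: n; apply: IHs => //; exact: divr_gt0.
(* Subtracting a multiple of [e] keeps [y] orthogonal to [s], since [e] itself is orthogonal to
   [s]. *)
exists (y - proj_coef e y *: e); split.
- exact: le_trans (norm_sub_proj_le _ _) y1.
- apply/andP; split; first by rewrite dot_swap_eq0// proj_coef_orthogonal.
  apply/allP => u us; rewrite linearBr linearZr_LR /=.
  rewrite (eqP (allP y_ortho u us)) sub0r oppr_eq0.
  by rewrite (dot_swap_eq0 _ _ (eqP (allP e_ortho u us))) mulr0.
rewrite opprB addrCA addrC linearD /= (splitr d) (le_trans (ler_normD _ _))//.
rewrite lerD// linearZ /= normrZ.
have Ae : `|A n e| <= d / 2 * `|e| by near: n.
apply: le_trans (ler_wpM2l (normr_ge0 _) Ae) _.
rewrite mulrCA ler_piMr ?divr_ge0 ?(ltW d0)//.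
rewrite (le_trans _ y1)// -(@ler_pXn2r _ 2) ?nnegrE ?mulr_ge0//.
by rewrite [leRHS](pythagoras_proj e y) lerDr exprn_ge0.
Unshelve. all: by end_near. Qed.

(** The gliding hump: pairs of an index and a vector are chosen together. The next index lies beyond
    all earlier ones and beyond the threshold at which making [x] orthogonal to the earlier vectors
    costs at most [d / 2]. *)
Lemma orthogonal_sequence_lower_bound (A : nat -> {linear X -> Y}) (d : K) :
    0 < d -> (forall x, A n x @[n --> \oo] --> 0) ->
    (forall N, exists2 n, (N <= n)%N & exists2 x, `|x| <= 1 & d < `|A n x|) ->
  exists phi : nat -> nat, exists x : nat -> X,
    [/\ increasing_seq phi, forall i j, (i < j)%N -> dot (x i) (x j) = 0,
        forall i, `|x i| <= 1 & forall i, d / 2 < `|A (phi i) (x i)|].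
Proof.
move=> d0 A0 A_large.
pose P (p : nat * X) := (`|p.2| <= 1) && (d / 2 < `|A p.1 p.2|).
pose r (p q : nat * X) := (p.1 < q.1)%N && (dot p.2 q.2 == 0).
have [s Ps rs|u uP ur] := @pairwise_sequence _ P r.
  have [||N _ approx] := eventually_orthogonal_approx A (map snd s) A0 _ (d / 2).
  - by rewrite pairwise_map; apply: sub_pairwise rs => p q /andP[].
  - exact: divr_gt0.
  have [n n_ge [x x1 Ax]] := A_large (maxn N (\max_(p <- s) p.1).+1).
  move: n_ge; rewrite geq_max => /andP[/approx/(_ x x1)[y [y1 y_ortho Axy]] n_gt].
  exists (n, y).
    rewrite /P /= y1 /= -(ltrD2l (d / 2)) -splitr (lt_le_trans Ax)//.
    by rewrite -{1}(subrK y x) linearD (le_trans (ler_normD _ _))// lerD2r.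
  apply/allP => p ps; apply/andP; split.
    by apply: leq_trans n_gt; rewrite ltnS (@leq_bigmax_seq _ s xpredT fst).
  by apply: (allP y_ortho); apply: map_f.
exists (fst \o u), (snd \o u); split=> [|i j /ur/andP[_ /eqP]//|i|i].
- by apply/increasing_seqP => n; have /andP[] := ur n n.+1 (leqnn _).
- by have /andP[] := uP i.
- by have /andP[] := uP i.
Qed.

End Geometry.

(** * Compactness of the limit and uniform convergence *)

Section Operators.
Context {K : numFieldType}.

Lemma bounded_operator_continuous {X Y : normedModType K} (f : {linear X -> Y}) :
  bounded_operator f -> continuous f.
Proof.
move=> [M f_le]; apply: bounded_linear_continuous.
(* [M] is any scalar, so a real bound is built from its norm; [0 <= M] follows only once some [x] is
   nonzero. *)
exists (`|M| + 1); split; first by rewrite ger0_real// addr_ge0.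
move=> N MN; near=> x; apply: le_trans (f_le x) _.
have x1 : `|x| <= 1 by near: x; exact: nbhs0_le.
have [->|x0] := eqVneq x 0.
  by rewrite normr0 mulr0 (le_trans _ (ltW MN))// addr_ge0.
have M_ge0 : 0 <= M.
  have := le_trans (normr_ge0 _) (f_le x).
  by rewrite pmulr_lge0// normr_gt0.
rewrite (le_trans _ (ltW MN))// (ger0_norm M_ge0).
by rewrite (le_trans (ler_piMr _ x1))// lerDl.
Unshelve. all: by end_near. Qed.

Context {X Y : normedModType K}.

Lemma collectively_compact_limit (T : nat -> {linear X -> Y})
    (T0 : {linear X -> Y}) :
    collectively_compact (range T) ->
    (forall x, T n x @[n --> \oo] --> T0 x) ->
  compact_operator T0.
Proof.
move=> [_]; set C := (X in precompact X) => C_precompact T_cvg.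
apply: (@precompact_subset _ _ (closure C)); last first.
  by rewrite precompact_closed; [rewrite -precompactE|exact: closed_closure].
move=> _ [x x1 <-]; apply: (closed_cvg _ (@closed_closure _ C) _ _ (T_cvg x)).
by apply: nearW => n; apply: subset_closure; exists (T n) => //; exists x.
Qed.

(** Compactness provides a cluster point [y], the limit along a finer filter [G]. Pairing with [y]
    gives [dot y y] along [G], but 0 by weak convergence, so [y = 0]. *)
Lemma compact_weak_null (T0 : {linear X -> Y}) (theta : K -> K)
    (dot : {dot Y for theta}) (x : nat -> X) :
    (forall y : Y, `|y| ^+ 2 = dot y y) ->
    bounded_operator T0 -> compact_operator T0 ->
    (forall n, `|x n| <= 1) -> weak_cvg x 0 ->
  cluster (T0 (x n) @[n --> \oo]) 0.
Proof.
move=> norm_dot T0_bounded T0_compact x1 x_weak.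
pose F := T0 (x n) @[n --> \oo].
have F_compact : compact (closure (T0 @` unit_ball)) by rewrite -precompactE.
have [|y [_ Fy]] := F_compact F.
  by exists 0%N => // n _; apply: subset_closure; exists (x n) => //; exact: x1.
suff y0 : y = 0 by rewrite -{1}y0.
have dot_le v : `|dot v y| <= `|y| * `|v|.
  by rewrite mulrC; exact: cauchy_schwarz.
pose g : {scalar Y} := applyr dot y.
have g_cont : continuous g.
  by apply: (@bounded_operator_continuous Y K^o g); exists `|y|.
pose h : {scalar X} := applyr dot y \o T0.
have h_cont : continuous h.
  move=> u; apply: continuous_comp; last exact: g_cont.
  exact: bounded_operator_continuous.
have gF : g @ F --> 0 by have := x_weak h h_cont; rewrite linear0.
have [G GG [Gy FG]] : exists2 G, ProperFilter G & G --> y /\ F `<=` G.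
  by move: Fy; rewrite cluster_cvgE.
have gG0 : g @ G --> 0 by apply: cvg_trans gF => A /FG.
have gGy : g @ G --> g y by apply: cvg_trans (g_cont y) => A /Gy.
have : dot y y = 0 by exact: (cvg_unique (@norm_hausdorff K K) gGy gG0).
by move/eqP; rewrite -norm_dot expf_eq0 normr_eq0 => /eqP.
Qed.

Lemma collectively_compact_cvg_uniform (theta0 theta1 : K -> K)
    (dot0 : {dot X for theta0}) (dot1 : {dot Y for theta1})
    (T : nat -> {linear X -> Y}) (T0 : {linear X -> Y}) :
    (forall c : K, 0 <= c -> exists n : nat, c < n%:R) ->
    (forall x : X, `|x| ^+ 2 = dot0 x x) ->
    (forall y : Y, `|y| ^+ 2 = dot1 y y) ->
    bounded_operator T0 -> compact_operator T0 ->
    (forall x, T n x @[n --> \oo] --> T0 x) ->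
    (forall phi : nat -> nat, increasing_seq phi ->
      weak_subsequence_property (fun n => T (phi n)) T0) ->
  forall d : K, 0 < d ->
    \forall n \near \oo, forall x, `|x| <= 1 -> `|T n x - T0 x| <= d.
Proof.
move=> archi norm_dot0 norm_dot1 T0_bounded T0_compact T_cvg T_weak d d0.
apply: contrapT => not_uniform.
pose A n : {linear X -> Y} := T n \- T0.
have A0 x : A n x @[n --> \oo] --> 0.
  by rewrite -(subrr (T0 x)); apply: cvgB (T_cvg x) (cvg_cst _).
have [N|phi [x [phi_incr x_ortho x1 Ax]]] :=
  orthogonal_sequence_lower_bound dot0 norm_dot0 A d d0 A0.
  apply: contrapT => small; apply: not_uniform; exists N => // n Nn x x1.
  rewrite real_leNgt ?normr_real ?gtr0_real//; apply/negP => ?; apply: small.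
  by exists n => //; exists x.
have x_weak : weak_cvg x 0 by exact: orthogonal_weak_cvg0.
(* The vector [x i] belongs to the operator [T (phi i)], so the property is applied to the operators
   reindexed by [phi]. *)
have [psi psi_incr] := T_weak phi phi_incr x 0 x_weak.
rewrite linear0 => Tx.
have psi_weak : weak_cvg (x \o psi) 0.
  by move=> f /x_weak; apply: cvg_comp; exact: increasing_seq_cvg_infty.
have d4 : 0 < d / 2 / 2 by rewrite !divr_gt0.
(* Of the lower bound [d / 2] for the difference, the null term [T (phi (psi n)) (x (psi n))]
   eventually takes less than half. *)
have T0_large : \forall n \near \oo, d / 2 / 2 < `|T0 (x (psi n))|.
  near=> n; rewrite -(ltrD2l (d / 2 / 2)) -splitr (lt_trans (Ax (psi n)))//.
  rewrite (le_lt_trans (ler_normB _ _))// ltrD2r.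
  by near: n; exact: cvgr0_norm_lt.
have T0_small : nbhs (0 : Y) [set v | `|v| < d / 2 / 2].
  by apply/nbhs_norm0P; exists (d / 2 / 2).
have [v []] := compact_weak_null T0 _ _ _ norm_dot1 T0_bounded T0_compact
  (fun n => x1 (psi n)) psi_weak [set v | d / 2 / 2 < `|v|] _ T0_large T0_small.
by move=> /lt_trans /[apply]; rewrite ltxx.
Unshelve. all: by end_near. Qed.

End Operators.

(** * Real and complex scalars, and the operator norm *)

Lemma scalars_archi (R : realType) (k : scalar_kind) (c : scalars R k) :
  0 <= c -> exists n : nat, c < n%:R.
Proof.
case: k c => /= c c0.
  by exists (Num.bound c); exact: archi_boundP.
exists (Num.bound (complex.Re c)).
(* In the order of [R[i]], [0 <= c] forces a zero imaginary part, so bounding the real part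
   suffices. *)
move: c0; rewrite lecE /= => /andP[/eqP im0 re0].
by rewrite -(rmorph_nat (real_complex R)) ltcE /= im0 eqxx archi_boundP.
Qed.

Lemma operator_norm_cvg0 (R : realType) (k : scalar_kind)
    (X Y : normedModType (scalars R k)) (A : nat -> {linear X -> Y}) :
    (forall d : scalars R k, 0 < d ->
      \forall n \near \oo, forall x, `|x| <= 1 -> `|A n x| <= d) ->
  operator_norm (A n) @[n --> \oo] --> 0%E.
Proof.
move=> A_small.
have norm_ge0 n : (0 <= operator_norm (A n))%E.
  apply: ereal_sup_ubound; exists 0; first by rewrite /unit_ball /= normr0.
  by rewrite linear0 normr0; case: k {X Y A A_small}.
have norm_le (e : R) : 0 < e ->
    \forall n \near \oo, (operator_norm (A n) <= e%:E)%E.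
  move=> e0; have [d d0 d_le] : exists2 d : scalars R k, 0 < d &
      forall z : scalars R k, z <= d -> scalar_re z <= e.
    case: (k) => /=; first by exists e.
    by exists e%:C%C => [|z]; rewrite ?ltcR// lecE => /andP[].
  have := A_small d d0; apply: filterS => n An.
  by apply: ge_ereal_sup => _ [x x1 <-]; rewrite lee_fin d_le// An.
(* Convergence in the extended reals to a finite limit needs eventual finiteness, supplied by the
   bound 1, and convergence of the real values. *)
apply/fine_cvgP; split.
  have := norm_le 1 ltr01; apply: filterS => n n_le.
  by rewrite ge0_fin_numE// (le_lt_trans n_le)// ltry.
apply/cvgr0Pnorm_le => e e0; have := norm_le e e0; apply: filterS => n n_le /=.
have n_fin : operator_norm (A n) \is a fin_num.
  by rewrite ge0_fin_numE// (le_lt_trans n_le)// ltry.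
by rewrite ger0_norm ?fine_ge0// -lee_fin fineK.
Qed.

Theorem theorem2p5 (R : realType) (k : scalar_kind)
  (H0 H1 : completeNormedModType (scalars R k))
  (dot0 : {dot H0 for @scalar_conj R k})
  (dot1 : {dot H1 for @scalar_conj R k})
  (norm_dot0 : induces_norm dot0)
  (norm_dot1 : induces_norm dot1)
  (T : nat -> {linear H0 -> H1}) (T0 : {linear H0 -> H1})
  (T_compact : forall n, compact_operator (T n))
  (T_collectively_compact : collectively_compact (range T))
  (T0_bounded : bounded_operator T0)
  (T_strong : forall x : H0, T n x @[n --> \oo] --> T0 x)
  (T_weak : forall phi : nat -> nat, increasing_seq phi ->
     weak_subsequence_property (fun n => T (phi n)) T0) :
  compact_operator T0 /\
  operator_norm (T n \- T0) @[n --> \oo] --> 0%E.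
Proof.
have T0_compact : compact_operator T0 by exact: collectively_compact_limit T_strong.
split=> //; pose A n : {linear H0 -> H1} := T n \- T0.
have A_cvg0 : operator_norm (A n) @[n --> \oo] --> 0%E.
  apply: operator_norm_cvg0.
  apply: (collectively_compact_cvg_uniform _ _ dot0 dot1) => //.
  exact: scalars_archi.
exact: A_cvg0.
Qed.
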